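(* Fix one of the types A, B, D below, and let $u=1$ for type A and $u=\tfrac12$ for types B and D. For every $\varepsilon\in(0,\tfrac12)$ there exist $\delta=\delta(\varepsilon)\in(0,1)$ and $C=C(\varepsilon)>0$ such that for all $d,n$ with $n>e^{d/(u-\varepsilon)}$ and every tuple $(\xi'_1,\dots,\xi'_n)$ of random vectors in $\mathbb{R}^d$ satisfying all assumptions of that type except possibly the general position assumption, the associated convex hull $H'_{n,d}$ satisfies $$\mathbb{P}[0\in H'_{n,d}]\ge1-Cn^{-\delta}.$$
   Context: For a tuple $(\xi'_1,\dots,\xi'_n)$ of random vectors in $\mathbb{R}^d$, put $S'_k=\xi'_1+\dots+\xi'_k$ and $(S_n^* )'=S'_{n-1}-\xi'_n$. Type A: $n\ge d+1$; the tuple is exchangeable ($(\xi'_1,\dots,\xi'_n)\stackrel{d}{=}(\xi'_{\sigma(1)},\dots,\xi'_{\sigma(n)})$ for all permutations $\sigma$); $S'_n=0$ a.s.; general position assumption: any $d$ vectors among $S'_1,\dots,S'_{n-1}$ are linearly independent a.s.; $H'_{n,d}=\mathrm{Conv}(S'_1,\dots,S'_{n-1})$. Type B: $n\ge d$; $(\xi'_1,\dots,\xi'_n)\stackrel{d}{=}(\varepsilon_1\xi'_{\sigma(1)},\dots,\varepsilon_n\xi'_{\sigma(n)})$ for all permutations $\sigma$ and all signs $\varepsilon_i\in\{-1,1\}$; general position assumption: any $d$ vectors among $S'_1,\dots,S'_n$ are linearly independent a.s.; $H'_{n,d}=\mathrm{Conv}(S'_1,\dots,S'_n)$. Type D: $n\ge\max\{2,d\}$;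 the same invariance as type B but only for signs with $\varepsilon_1\cdots\varepsilon_n=1$; general position assumption: any $d$ vectors from either collection $S'_1,\dots,S'_n$ or $S'_1,\dots,S'_{n-1},(S_n^* )'$ are linearly independent a.s.; $H'_{n,d}=\mathrm{Conv}(S'_1,\dots,S'_n,(S_n^* )')$. *)

(* Defs.v *)
From HB Require Import structures.
From mathcomp Require Import all_boot all_order all_algebra all_fingroup.
From mathcomp Require Import all_classical all_reals all_analysis.
Set Implicit Arguments. Unset Strict Implicit. Unset Printing Implicit Defensive.
Import Order.TTheory GRing.Theory Num.Theory.
Local Open Scope classical_set_scope.
Local Open Scope ring_scope.

Inductive walk_type := TypeA | TypeB | TypeD.

Definition u_of {R : realType} (t : walk_type) : R :=
  match t with TypeA => 1 | _ => 2^-1 end.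

Definition in_conv {R : realType} {d : nat} (s : seq 'rV[R]_d) (x : 'rV[R]_d) : Prop :=
  exists l : nat -> R, (forall i, 0 <= l i) /\
    \sum_(i < size s) l i = 1 /\ \sum_(i < size s) l i *: s`_i = x.

Definition coord_halfspaces {R : realType} (n d : nat) : set (set ('I_n -> 'rV[R]_d)) :=
  [set A | exists (i : 'I_n) (j : 'I_d) (c : R), A = [set x : 'I_n -> 'rV[R]_d | x i ord0 j <= c]].

Definition borel_tuple {R : realType} (n d : nat) : set (set ('I_n -> 'rV[R]_d)) :=
  <<s (@coord_halfspaces R n d) >>.

Definition same_law {R : realType} {dT} {T : measurableType dT} (P : probability T R)
  {n d : nat} (X Y : T -> 'I_n -> 'rV[R]_d) : Prop :=
  forall A, borel_tuple A -> P (X @^-1` A) = P (Y @^-1` A).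

Definition random_tuple {R : realType} {dT} {T : measurableType dT}
  {n d : nat} (X : T -> 'I_n -> 'rV[R]_d) : Prop :=
  forall (i : 'I_n) (j : 'I_d), measurable_fun setT (fun w => X w i ord0 j).

(* Partial sums S'_k = xi'_1 + ... + xi'_k (xi'_{i+1} is X w i). *)
Definition psum {R : realType} {n d : nat} (x : 'I_n -> 'rV[R]_d) (k : nat) : 'rV[R]_d :=
  \sum_(i < n | (i < k)%N) x i.

Definition psum_star {R : realType} {n d : nat} (x : 'I_n -> 'rV[R]_d) : 'rV[R]_d :=
  psum x n.-1 - \sum_(i < n | i == n.-1 :> nat) x i.

Definition is_sign {R : realType} {n : nat} (e : 'I_n -> R) : Prop :=
  forall i, e i = 1 \/ e i = -1.

Definition walk_assumptions {R : realType} (t : walk_type) {dT} {T : measurableType dT}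
  (P : probability T R) {n d : nat} (X : T -> 'I_n -> 'rV[R]_d) : Prop :=
  random_tuple X /\
  match t with
  | TypeA =>
      (d.+1 <= n)%N /\
      (forall s : 'S_n, same_law P X (fun w i => X w (s i))) /\
      P [set w | psum (X w) n = 0] = 1%E
  | TypeB =>
      (d <= n)%N /\
      (forall (s : 'S_n) (e : 'I_n -> R), is_sign e ->
         same_law P X (fun w i => e i *: X w (s i)))
  | TypeD =>
      (maxn 2 d <= n)%N /\
      (forall (s : 'S_n) (e : 'I_n -> R), is_sign e -> \prod_i e i = 1 ->
         same_law P X (fun w i => e i *: X w (s i)))
  end.

Definition hull_points {R : realType} (t : walk_type) {n d : nat} (x : 'I_n -> 'rV[R]_d)
  : seq 'rV[R]_d :=
  match t with
  | TypeA => [seq psum x k | k <- iota 1 n.-1]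
  | TypeB => [seq psum x k | k <- iota 1 n]
  | TypeD => rcons [seq psum x k | k <- iota 1 n] (psum_star x)
  end.

(* Main.v *)
(* By invariance, P[0 in H'] is the average, over (signed) permutations g, of
   P[0 in H'(g xi)], so it suffices to bound, for deterministic vectors, the
   proportion of g for which the hull misses 0.  By Abel summation 0 lies in the
   hull for g as soon as the space M of linear relations between the vectors meets
   the closed Weyl chamber of g nontrivially.  Fix a chamber for the first n vectors
   and insert the coordinate of vector n+1 in all possible ways: the chambers above
   it form a path whose edges are walls, and a wall met by M has both adjacent
   chambers met by M.  As a path has one more vertex than edges, this bounds the
   number of chambers met from below by the number of walls met (relations after
   merging, or in type B deleting, a vector) plus one if the fiber is met at all
   (relations modulo the last vector, where the rank has dropped by one).  Hence the
   bad proportion g(n, d) satisfies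
   g(n+1, d) <= (1 - u/(n+1)) g(n, d) + u/(n+1) g(n, d-1), and induction gives
   g(n, d) <= 2 (n+1)^(-u(1-s)) s^(-d) for every 0 < s < 1; take s = 1 - eps/u.
   Type D reduces to type B, because flipping the sign of the last step preserves the
   type D hull, which contains the type B hull. *)
Require Import Defs.
From HB Require Import structures.
From mathcomp Require Import all_boot all_order all_algebra all_fingroup.
From mathcomp Require Import all_classical all_reals all_analysis.
From mathcomp Require Import measurable_realfun ring lra zify.
Import Order.TTheory GRing.Theory Num.Theory.
Local Open Scope classical_set_scope.
Local Open Scope ring_scope.
Set Implicit Arguments. Unset Strict Implicit. Unset Printing Implicit Defensive.

(** * Gordan's alternative and separation of 0 from a finite set *)

Lemma exists_lt_bound (R : realFieldType) (T : eqType) (r : seq T) (f : T -> R) (c : R) :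
  (forall v, v \in r -> f v < c) -> exists2 a, a < c & forall v, v \in r -> f v < a.
Proof.
elim: r => [|v r IH] h; first by exists (c - 1) => //; lra.
have [a ac ha] := IH (fun w wr => h w (mem_behead (s := v :: r) wr)).
have vc := h v (mem_head _ _).
exists (Num.max a ((f v + c) / 2)); first by rewrite gt_max ac; lra.
move=> w; rewrite inE lt_max => /orP[/eqP->|/ha -> //].
by apply/orP; right; lra.
Qed.

Lemma exists_bound (R : realFieldType) (T : eqType) (r : seq T) (f : T -> R) :
  exists c, forall v, v \in r -> f v < c.
Proof.
elim: r => [|v r [c hc]]; first by exists 0.
exists (Num.max c (f v + 1)) => w; rewrite inE lt_max => /orP[/eqP->|/hc -> //].
by apply/orP; right; lra.
Qed.

Section Gordan.
Context {R : realType} {d : nat}.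
Implicit Types (s : seq 'rV[R]_d) (u v y : 'rV[R]_d).

Definition dot u y : R := \sum_j u ord0 j * y ord0 j.

Lemma dotDr u y z : dot u (y + z) = dot u y + dot u z.
Proof. by rewrite /dot -big_split; apply: eq_bigr => j _; rewrite mxE mulrDr. Qed.

Lemma dotZr u a y : dot u (a *: y) = a * dot u y.
Proof. by rewrite /dot mulr_sumr; apply: eq_bigr => j _; rewrite mxE; ring. Qed.

Lemma dotC u y : dot u y = dot y u.
Proof. by apply: eq_bigr => j _; rewrite mulrC. Qed.

Lemma dotBl u v y : dot (u - v) y = dot u y - dot v y.
Proof. by rewrite dotC dotDr -scaleN1r dotZr mulN1r dotC [dot y v]dotC. Qed.

Lemma dotZl a u y : dot (a *: u) y = a * dot u y.
Proof. by rewrite dotC dotZr dotC. Qed.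

Lemma dot_suml n (a : nat -> R) (f : nat -> 'rV[R]_d) y :
  dot (\sum_(i < n) a i *: f i) y = \sum_(i < n) a i * dot (f i) y.
Proof.
elim: n => [|n IH]; last by rewrite !big_ord_recr /= -IH dotC dotDr dotC -dotZl [dot y _]dotC.
by rewrite !big_ord0 /dot big1 // => j _; rewrite mxE mul0r.
Qed.

Lemma dot_gt0 u : u != 0 -> 0 < dot u u.
Proof.
move=> /rV0Pn[j uj]; rewrite /dot (bigD1 j) //= ltr_pwDl //.
  by rewrite -expr2 exprn_even_gt0.
by apply: sumr_ge0 => i _; rewrite -expr2 sqr_ge0.
Qed.

Definition cone_relation s := exists l : nat -> R,
  [/\ forall i, 0 <= l i, 0 < \sum_(i < size s) l i & \sum_(i < size s) l i *: s`_i = 0].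

Definition open_halfspace s y := forall v, v \in s -> 0 < dot v y.

(* If [y] is positive on [s] but not on [a], eliminate [y]: the vectors
   [dot v y *: a - dot a y *: v] are nonnegative combinations orthogonal to [y]. *)
Lemma gordan s : cone_relation s \/ exists y, open_halfspace s y.
Proof.
have [n sn] := ubnP (size s); elim: n s sn => // n IH [|a s] /=.
  by move=> _; right; exists 0.
rewrite ltnS => sn; have [[l [l0 l1 l2]]|[y hy]] := IH s sn.
  left; exists (fun i => if i is k.+1 then l k else 0); split => /=.
  - by case.
  - by rewrite big_ord_recl /= add0r.
  - by rewrite big_ord_recl /= scale0r add0r.
have [b0|b0] := ltrP 0 (dot a y).
  by right; exists y => v; rewrite inE => /orP[/eqP->|/hy].
(* The case [b = 0] below needs some element of [s] to deduce [0 < dot a y']. *)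
have [s0|[a1 a1s]] : s = [::] \/ exists a1, a1 \in s.
  by case: (s) => [|a1 s']; [left | right; exists a1; exact: mem_head].
  rewrite s0; have [->|a_neq0] := eqVneq a 0.
    left; exists (fun=> 1); split => //=; first by rewrite big_ord1.
    by rewrite big_ord1 scaler0.
  by right; exists a => v; rewrite inE => /eqP->; exact: dot_gt0.
set b := dot a y in b0 *.
pose f v := dot v y *: a - b *: v.
have := IH (map f s); rewrite size_map => /(_ sn)[[l []]|[y' hy']].
  rewrite size_map => l0 l1 l2; left.
  have sy (i : 'I_(size s)) : 0 < dot s`_i y by apply: hy; exact: mem_nth.
  pose L := \sum_(i < size s) l i * dot s`_i y.
  have L0 : 0 < L.
    rewrite lt_neqAle sumr_ge0 ?andbT; last by move=> i _; rewrite mulr_ge0 ?l0 ?ltW ?sy.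
    apply/negP; rewrite eq_sym psumr_eq0 => [/allP h|i _]; last by rewrite mulr_ge0 ?l0 ?ltW ?sy.
    move: l1; rewrite big1 ?ltxx // => i _.
    by have := h i (mem_index_enum _); rewrite /= mulf_eq0 (gt_eqF (sy i)) orbF => /eqP.
  exists (fun i => if i is k.+1 then - b * l k else L); split => /=.
  - by case=> [|i]; [exact: ltW | rewrite mulr_ge0 ?oppr_ge0].
  - rewrite big_ord_recl /= ltr_pwDl // sumr_ge0 // => i _.
    by rewrite mulr_ge0 // oppr_ge0.
  - rewrite big_ord_recl /= -[RHS]l2 /L scaler_suml -big_split; apply: eq_bigr => i _ /=.
    rewrite add0n (nth_map 0) // /f scalerBr !scalerA -scaleNr; congr (_ + _ *: _).
    by ring.
have ht v : v \in s -> 0 < dot v y * dot a y' - b * dot v y'.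
  by move=> vs; have := hy' _ (map_f f vs); rewrite /f dotBl !dotZl.
(* [y' + al *: y] works once [al] exceeds the ratios coming from [s] and respects the constraint
   from [a]; [ht] makes the two compatible. *)
suff [al al1 al2] : exists2 al, 0 < dot a y' + al * b &
    forall v, v \in s -> - dot v y' / dot v y < al.
  right; exists (y' + al *: y) => v; rewrite inE dotDr dotZr => /orP[/eqP-> //|vs].
  by have := al2 v vs; rewrite ltr_pdivrMr ?hy //; lra.
have [b_eq0|b_neq0] := eqVneq b 0.
  have [c hc] := exists_bound s (fun v => - dot v y' / dot v y).
  exists c => //; rewrite b_eq0 mulr0 addr0.
  have := ht a1 a1s; rewrite b_eq0 mul0r subr0 pmulr_rgt0 //.
  exact: hy.
have {b_neq0}b0 : b < 0 by rewrite lt_neqAle b_neq0.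
have [v vs|al al1 al2] := @exists_lt_bound _ _ s (fun v => - dot v y' / dot v y) (- dot a y' / b).
  rewrite ltr_pdivrMr ?hy // mulrAC ltr_ndivlMr //; have := ht v vs; lra.
by exists al => //; move: al1; rewrite ltr_ndivlMr //; lra.
Qed.

(** Pairing a convex combination equal to 0 with [y] would give a positive number; conversely a cone
    relation is normalised to total weight 1. *)
Lemma in_conv0P s : in_conv s 0 <-> ~ exists y, open_halfspace s y.
Proof.
split=> [[l [l0 [l1 l2]]] [y hy]|hy].
  have : \sum_(i < size s) l i * dot s`_i y = 0.
    rewrite -dot_suml l2; rewrite /dot big1 // => j _; by rewrite mxE mul0r.
  have sy (i : 'I_(size s)) : 0 < dot s`_i y by apply: hy; exact: mem_nth.
  move/eqP; rewrite psumr_eq0 => [/allP h|i _]; last by rewrite mulr_ge0 ?l0 ?ltW ?sy.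
  move: l1; rewrite big1 => [/eqP|i _]; first by rewrite eq_sym oner_eq0.
  by have := h i (mem_index_enum _); rewrite /= mulf_eq0 (gt_eqF (sy i)) orbF => /eqP.
have [[l [l0 l1 l2]]|//] := gordan s.
set L := \sum_(i < _) _ in l1.
exists (fun i => l i / L); split; first by move=> i; rewrite divr_ge0 // ltW.
split; first by rewrite -mulr_suml divff // gt_eqF.
transitivity (L^-1 *: \sum_(i < size s) l i *: s`_i); last by rewrite l2 scaler0.
rewrite scaler_sumr; apply: eq_bigr => i _.
by rewrite scalerA mulrC.
Qed.

(** Finitely many strict inequalities survive a small perturbation. Rational witnesses turn missing
    0 into a countable union, hence a measurable event. *)
Lemma open_halfspace_rat s y : open_halfspace s y ->
  exists q : 'rV[rat]_d, open_halfspace s (map_mx ratr q).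
Proof.
move=> hy.
have [e e0 he] := @exists_lt_bound _ _ s (fun v => - dot v y) 0
  (fun v vs => ltac:(by rewrite oppr_lt0; exact: hy)).
have [M hM] := exists_bound s (fun v => \sum_j `|v ord0 j|).
(* Every [dot v y] exceeds the margin [- e] and [M] bounds the l1 norms on [s], so moving each
   coordinate of [y] by less than [c] keeps all signs. *)
pose c := - e / (Num.max M 1).
have M1 : 0 < Num.max M 1 by rewrite lt_max ltr01 orbT.
have c0 : 0 < c by rewrite divr_gt0 // oppr_gt0.
have /choice[q hq] : forall j, exists r : rat, `|ratr r - y ord0 j| < c.
  move=> j; have [r] := @rat_in_itvoo R (y ord0 j - c) (y ord0 j + c) ltac:(lra).
  by rewrite in_itv /= => /andP[h1 h2]; exists r; rewrite ltr_norml; lra.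
exists (\row_j q j) => v vs.
have h1 : `|dot v (map_mx ratr (\row_j q j)) - dot v y| <= \sum_j `|v ord0 j| * c.
  rewrite /dot -sumrB; apply: le_trans (ler_norm_sum _ _ _) _.
  apply: ler_sum => j _; rewrite !mxE -mulrBr normrM ler_wpM2l //.
  exact/ltW/hq.
have h2 : \sum_j `|v ord0 j| * c <= - e.
  rewrite -mulr_suml /c mulrA ler_pdivrMr // [X in X <= _]mulrC ler_wpM2l ?oppr_ge0 ?ltW //.
  by rewrite lt_max hM.
have := he v vs; move: (le_trans h1 h2); rewrite ler_norml => /andP[h3 _]; lra.
Qed.

End Gordan.

(** * Signed permutations as words built by insertion *)

Definition insert_at {T : Type} (z : T) (k : nat) (p : seq T) : seq T :=
  take k p ++ z :: drop k p.

Lemma perm_insert_at (T : eqType) (z : T) k p : perm_eq (insert_at z k p) (z :: p).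
Proof. by rewrite /insert_at -cat1s perm_catCA /= perm_cons cat_take_drop. Qed.

Lemma map_insert_at (T U : Type) (f : T -> U) z k p :
  map f (insert_at z k p) = insert_at (f z) k (map f p).
Proof. by rewrite /insert_at map_cat /= map_take map_drop. Qed.

(** A copy of entry [k] fits on either side of it. The two slots stand for the two chambers sharing
    the wall where the new coordinate equals entry [k]. *)
Lemma pairwise_insert_dup (T : Type) (r : rel T) (x0 : T) (s : seq T) k :
  reflexive r -> (k < size s)%N -> pairwise r s ->
  pairwise r (insert_at (nth x0 s k) k s) /\ pairwise r (insert_at (nth x0 s k) k.+1 s).
Proof.
move=> rr ks; rewrite /insert_at (take_nth x0 ks) cat_rcons (drop_nth x0 ks).
set v := nth x0 s k; rewrite -{1}(cat_take_drop k s) (drop_nth x0 ks) -/v.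
rewrite !pairwise_cat !allrel_consr /= rr => /and3P[/andP[-> ->] -> /andP[-> ->]].
by [].
Qed.

Lemma pairwise_insert_ge (R : realDomainType) (v : R) (s : seq R) :
  pairwise >=%R s -> exists2 k, (k <= size s)%N & pairwise >=%R (insert_at v k s).
Proof.
elim: s => [|a s IH] /=; first by exists 0%N.
move=> /andP[ha /IH[k ks hk]]; have [va|av] := lerP v a.
  exists k.+1 => //=; move: hk; rewrite /insert_at /= => ->; rewrite andbT.
  have := perm_all (>=%R a) (perm_insert_at v k s).
  by rewrite /insert_at => ->; rewrite /= va ha.
exists 0%N => //; rewrite /insert_at /= (ltW av) ha /=.
have sub : subseq s (insert_at v k s).
  by rewrite -{1}(cat_take_drop k s) cat_subseq // subseq_cons.
rewrite (subseq_pairwise sub hk) andbT.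
by apply: sub_all ha => z /le_trans; apply; exact: ltW.
Qed.

Definition signs (b : bool) : seq bool := if b then [:: false; true] else [:: false].

(** The pair at position [k] holds a sign bit and the index placed there. Inserting the largest
    index last groups the words into fibres over shorter words. *)
Fixpoint words (b : bool) (n : nat) : seq (seq (bool * nat)) :=
  if n is m.+1 then
    [seq insert_at (c.1, m) c.2 p
       | p <- words b m, c <- [seq (s, k) | s <- signs b, k <- iota 0 m.+1]]
  else [:: [::]].

Lemma wordsS b m : words b m.+1 =
  [seq insert_at (c.1, m) c.2 p
     | p <- words b m, c <- [seq (s, k) | s <- signs b, k <- iota 0 m.+1]].
Proof. by []. Qed.

Lemma wordsP b n p : p \in words b n ->
  perm_eq (map snd p) (iota 0 n) /\ (~~ b -> all (fun c => ~~ c.1) p).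
Proof.
elim: n p => [|n IH] p; first by rewrite inE => /eqP->.
rewrite wordsS => /allpairsP[[q [s k]] [/IH[pq hq] + ->]].
case/allpairsP=> -[s' k'] [ss' _ [-> ->]].
split.
  rewrite map_insert_at (permPl (perm_insert_at _ _ _)).
  by rewrite -[in iota _ n.+1]addn1 iotaD add0n cats1 perm_sym perm_rcons perm_sym perm_cons.
move=> nb; rewrite (perm_all _ (perm_insert_at _ _ _)) /= hq // andbT.
by move: ss'; rewrite /signs (negbTE nb) inE => /eqP/= ->.
Qed.

Lemma sum_words (S : nmodType) b n (F : seq (bool * nat) -> S) :
  \sum_(p <- words b n.+1) F p =
  \sum_(p <- words b n) \sum_(s <- signs b) \sum_(k < n.+1) F (insert_at (s, n) k p).
Proof.
rewrite wordsS big_allpairs_dep; apply: eq_bigr => p _.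
rewrite big_allpairs_dep; apply: eq_bigr => s _.
by rewrite -(big_mkord xpredT (fun k => F (insert_at (s, n) k p))) /index_iota subn0.
Qed.

(** * Chambers and walls met by the space of linear relations *)

Section Counting.
Context {R : realType} {d : nat}.
Implicit Types (b s : bool) (x : nat -> 'rV[R]_d) (mu : nat -> R) (p : seq (bool * nat)).

Definition signed_value mu (c : bool * nat) : R := (-1) ^+ c.1 * mu c.2.

Definition nontrivial (b : bool) (n : nat) mu : Prop :=
  exists i j : nat, [&& (i < n)%N, (j < n)%N & mu i != if b then 0 else mu j].

(* The closed Weyl chamber encoded by [p] meets the space of linear relations
   between the [x i] outside its trivial part (0 for signed permutations, the
   constants otherwise). *)
Definition meets_chamber (b : bool) (n : nat) x (p : seq (bool * nat)) : Prop :=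
  exists mu, [/\ \sum_(i < n) mu i *: x i = 0,
    pairwise >=%R (map (signed_value mu) p),
    b -> all (>= 0)%R (map (signed_value mu) p) & nontrivial b n mu].

(** Relations between these [n] vectors are the relations between [n.+1] vectors on the wall where
    coordinate [n] is [(-1) ^+ s] times coordinate [j]. *)
Definition merge x (n j : nat) (s : bool) (i : nat) : 'rV[R]_d :=
  if i == j then x j + (-1) ^+ s *: x n else x i.

(** Common tool for the four cases below: giving [mu] the value [c] at [n] changes nothing that [p]
    reads, as [p] uses only indices below [n]. *)
Lemma meets_insert b n x (p : seq (bool * nat)) mu (c : R) s k :
  perm_eq (map snd p) (iota 0 n) ->
  \sum_(i < n) mu i *: x i + c *: x n = 0 ->
  pairwise >=%R (insert_at ((-1) ^+ s * c) k (map (signed_value mu) p)) ->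
  (b -> 0 <= (-1) ^+ s * c) -> (b -> all (>= 0)%R (map (signed_value mu) p)) ->
  nontrivial b n.+1 (fun i => if i == n then c else mu i) ->
  meets_chamber b n.+1 x (insert_at (s, n) k p).
Proof.
move=> pp hs hp hc ha hn; set mu' := fun i => if i == n then c else mu i.
have E : map (signed_value mu') p = map (signed_value mu) p.
  apply/eq_in_map => -[e i] /(map_f snd); rewrite (perm_mem pp) mem_iota /=.
  by rewrite /signed_value /mu' /= => /ltn_eqF ->.
exists mu'; split => //.
- rewrite big_ord_recr /= {2}/mu' eqxx -[RHS]hs; congr (_ + _).
  by apply: eq_bigr => i _; rewrite /mu' (ltn_eqF (ltn_ord i)).
- by rewrite map_insert_at E {1}/signed_value /= /mu' eqxx.
- move=> hb; rewrite map_insert_at E (perm_all _ (perm_insert_at _ _ _)) /= ha //.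
  by rewrite {1}/signed_value /= /mu' eqxx hc.
Qed.

Lemma nontrivial_widen b n mu c : nontrivial b n mu ->
  nontrivial b n.+1 (fun i => if i == n then c else mu i).
Proof.
move=> [i [j /and3P[hi hj h]]]; exists i, j.
by rewrite !ltnS (ltnW hi) (ltnW hj) (ltn_eqF hi) (ltn_eqF hj).
Qed.

Lemma sum_merge n x j s (mu : nat -> R) : (j < n)%N ->
  \sum_(i < n) mu i *: merge x n j s i =
  \sum_(i < n) mu i *: x i + ((-1) ^+ s * mu j) *: x n.
Proof.
move=> jn; rewrite (bigD1 (Ordinal jn)) //= [in RHS](bigD1 (Ordinal jn)) //=.
rewrite {1}/merge eqxx scalerDr scalerA [mu j * _]mulrC -!addrA; congr (_ + _).
rewrite addrC; congr (_ + _); apply: eq_bigr => i ij; rewrite /merge.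
by rewrite -[X in X == _]/(val i) -[j]/(val (Ordinal jn)) val_eqE (negbTE ij).
Qed.

(** With the sign [s (+) c.1] the signed value of the new coordinate equals entry [k], so it can be
    inserted on both sides of that entry. *)
Lemma meets_merge b n x p s k (c := nth (false, 0%N) p k) :
  perm_eq (map snd p) (iota 0 n) -> (k < n)%N ->
  meets_chamber b n (merge x n c.2 (s (+) c.1)) p ->
  meets_chamber b n.+1 x (insert_at (s, n) k p) /\
  meets_chamber b n.+1 x (insert_at (s, n) k.+1 p).
Proof.
move=> pp kn [mu [hs hp ha hn]].
have sp : size p = n by have := perm_size pp; rewrite size_map size_iota.
have cn : (c.2 < n)%N.
  have : c.2 \in map snd p by apply/map_f/mem_nth; rewrite sp.
  by rewrite (perm_mem pp) mem_iota.
rewrite sum_merge // in hs; set y := _ * mu _ in hs.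
have yE : (-1) ^+ s * y = nth 0 (map (signed_value mu) p) k.
  rewrite (nth_map (false, 0%N)) ?sp // -/c /signed_value /y signr_addb.
  by rewrite mulrA mulrA -expr2 sqrr_sign mul1r.
have [] := @pairwise_insert_dup R >=%R 0 _ k (fun v => lexx v) _ hp.
  by rewrite size_map sp.
rewrite -yE => h1 h2.
have y0 : b -> 0 <= (-1) ^+ s * y.
  by move=> /ha/allP; apply; rewrite yE mem_nth // size_map sp.
by split; apply: (meets_insert pp hs) => //; exact: nontrivial_widen.
Qed.

(** The additional wall of the signed case: a new coordinate 0 goes after all the nonnegative
    entries, with either sign. *)
Lemma meets_delete n x p s : perm_eq (map snd p) (iota 0 n) ->
  meets_chamber true n x p -> meets_chamber true n.+1 x (insert_at (s, n) n p).
Proof.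
move=> pp [mu [hs hp ha hn]].
have sp : size p = n by have := perm_size pp; rewrite size_map size_iota.
apply: (@meets_insert _ _ _ _ mu 0) => //; rewrite ?scale0r ?addr0 ?mulr0 //.
  rewrite /insert_at -sp -(size_map (signed_value mu)) take_size drop_size.
  by rewrite cats1 pairwise_rcons hp andbT; exact: ha.
exact: nontrivial_widen.
Qed.

(** The kernel of [cokermx (x n)] is the line of [x n], so a relation in the quotient lifts with
    some coefficient at [x n]; sorting this coefficient in gives the slot. *)
Lemma meets_mod b n x p : perm_eq (map snd p) (iota 0 n) ->
  meets_chamber b n (fun i => x i *m cokermx (x n)) p ->
  exists2 s, s \in signs b & exists2 k, (k <= n)%N & meets_chamber b n.+1 x (insert_at (s, n) k p).
Proof.
move=> pp [mu [hs hp ha hn]].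
have sp : size p = n by have := perm_size pp; rewrite size_map size_iota.
have [c hc] : exists c, \sum_(i < n) mu i *: x i = c *: x n.
  apply/sub_rVP; rewrite submxE mulmx_suml; apply/eqP; rewrite -[RHS]hs.
  by apply: eq_bigr => i _; rewrite scalemxAl.
(* The new coefficient is [- c]; in the signed case the sign must make it nonnegative. *)
pose s := b && (0 < c).
have ss : s \in signs b by rewrite /s /signs; case: (b) => //=; case: (0 < c).
have [k ks hk] := @pairwise_insert_ge _ ((-1) ^+ s * - c) _ hp.
exists s => //; exists k; first by rewrite size_map sp in ks.
apply: (meets_insert pp _ hk) => //.
- by rewrite hc scaleNr subrr.
- rewrite /s => ->; have [c0|c0] := ltrP 0 c; first by rewrite expr1 mulN1r opprK ltW.
  by rewrite mul1r oppr_ge0.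
- exact: nontrivial_widen.
Qed.

(** A zero vector carries the relation with coefficient 1 on it alone. Without signs it is
    nontrivial because [0 < n] supplies a second index. *)
Lemma meets_zero b n x p : (0 < n)%N -> perm_eq (map snd p) (iota 0 n) -> x n = 0 ->
  meets_chamber b n.+1 x (insert_at (false, n) 0 p).
Proof.
move=> n0 pp xn.
have E : map (signed_value (fun=> 0)) p = map (fun=> 0) p.
  by apply: eq_map => c; rewrite /signed_value mulr0.
have pw (q : seq (bool * nat)) : pairwise >=%R (map (fun=> 0 : R) q).
  by elim: q => //= c q ->; rewrite andbT all_map; apply/allP => z _ /=.
apply: (@meets_insert _ _ _ _ (fun=> 0) 1) => //.
- by rewrite xn scaler0 addr0 big1 // => i _; rewrite scale0r.
- rewrite E /insert_at take0 drop0 /= mulr1 pw andbT all_map; apply/allP => z _ /=.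
  exact: ler01.
- by rewrite mulr1 ler01.
- by move=> _; rewrite E all_map; apply/allP => z _ /=.
- exists n, 0%N; rewrite !ltnSn eqxx (ltn_eqF n0) /=.
  by case: b; rewrite oner_neq0.
Qed.

End Counting.

(* On a path, the edges all of whose endpoints are marked span a forest, so they
   are outnumbered by the marked vertices. *)
Lemma marked_path_count (f w : nat -> bool) (n : nat) (e : bool) :
  (forall k, (k < n)%N -> w k -> f k && f k.+1) ->
  (e -> exists2 k, (k <= n)%N & f k) ->
  (\sum_(k < n) w k + e <= \sum_(k < n.+1) f k)%N.
Proof.
elim: n e => [|n IH] e hw he.
  rewrite big_ord0 big_ord1; case: e he => // /(_ isT)[k].
  by rewrite leqn0 => /eqP-> /= ->.
have {}IH e' := IH e' (fun k kn => hw k (ltnW kn)).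
rewrite big_ord_recr /= [X in (_ <= X)%N]big_ord_recr /=.
have [wn|wn] := boolP (w n).
  have /andP[fn fn1] := hw n (leqnn _) wn; rewrite fn1.
  have := IH true (fun _ => ex_intro2 _ _ n (leqnn _) fn).
  by case: (e) => /=; lia.
have [fn1|fn1] := boolP (f n.+1).
  by have := IH false; rewrite /= => /(_ (fun h => False_ind _ (notF h))); case: (e) => /=; lia.
suff /IH : e -> exists2 k, (k <= n)%N & f k by rewrite /= !addn0.
move=> /he[k]; rewrite leq_eqVlt => /orP[/eqP->|kn]; first by rewrite (negbTE fn1).
by exists k.
Qed.

(** * Recursion for the number of chambers met *)

Section Recursion.
Context {R : realType} {d : nat}.
Implicit Types (b s : bool) (x : nat -> 'rV[R]_d) (p : seq (bool * nat)).

Definition count_meets b n x : nat := \sum_(p <- words b n) `[< meets_chamber b n x p >].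

Lemma sum_signs b (e : bool) (G : bool -> nat) : (~~ b -> ~~ e) ->
  (\sum_(s <- signs b) G (s (+) e) = \sum_(s <- signs b) G s)%N.
Proof.
case: b; first by rewrite /signs !big_cons !big_nil; case: e => //= _; lia.
by move=> /(_ isT)/negbTE->; apply: eq_bigr => s _; rewrite addbF.
Qed.

Lemma sum_word n p (G : nat -> nat) : perm_eq (map snd p) (iota 0 n) ->
  (\sum_(k < n) G (nth (false, 0%N) p k).2 = \sum_(j < n) G j)%N.
Proof.
move=> pp; have sp : size p = n by have := perm_size pp; rewrite size_map size_iota.
rewrite -(big_mkord xpredT (fun k => G (nth (false, 0%N) p k).2)) -{1}sp.
rewrite -(big_nth _ xpredT (fun c => G c.2)) -(big_map snd xpredT) (perm_big _ pp).
by rewrite -(big_mkord xpredT) /index_iota subn0.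
Qed.

(** For each sign the slots over [p] form a path. In the signed case the wall where the new
    coordinate vanishes joins the two paths into one. *)
Lemma chamber_count b n x p (e : bool) : p \in words b n ->
  (e -> exists2 s, s \in signs b &
     exists2 k, (k <= n)%N & meets_chamber b n.+1 x (insert_at (s, n) k p)) ->
  (\sum_(s <- signs b) \sum_(j < n) `[< meets_chamber b n (merge x n j s) p >]
   + (b && `[< meets_chamber true n x p >]) + e
   <= \sum_(s <- signs b) \sum_(k < n.+1)
        `[< meets_chamber b n.+1 x (insert_at (s, n) k p) >])%N.
Proof.
move=> /wordsP[pp pb] he.
pose f s k := `[< meets_chamber b n.+1 x (insert_at (s, n) k p) >].
pose g k := nth (false, 0%N) p k.
pose w s k := `[< meets_chamber b n (merge x n (g k).2 (s (+) (g k).1)) p >].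
pose E s := `[< exists2 k, (k <= n)%N & f s k >].
have H s : (\sum_(k < n) w s k + E s <= \sum_(k < n.+1) f s k)%N.
  apply: marked_path_count => [k kn /asboolP /(meets_merge pp kn)[h1 h2]|/asboolP //].
  by apply/andP; split; apply/asboolP.
have := @leq_sum _ (signs b) xpredT _ _ (fun s _ => H s).
rewrite big_split /=; apply: leq_trans.
rewrite -addnA; apply: leq_add.
  (* Summed over all signs, the sign of entry [k] drops out, and the entries of [p] run once through
     all indices. *)
  rewrite [X in (_ <= X)%N]exchange_big /=.
  under [X in (_ <= X)%N]eq_bigr => k _.
    rewrite (sum_signs (fun s => `[< meets_chamber b n (merge x n (g k).2 s) p >] : nat)); last first.
      move=> /pb/allP; apply; apply: mem_nth.
      by have := perm_size pp; rewrite size_map size_iota => ->.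
    over.
  rewrite (sum_word (fun j => \sum_(s <- signs b) `[< meets_chamber b n (merge x n j s) p >])%N pp).
  by rewrite exchange_big.
have EP s k : (k <= n)%N -> meets_chamber b n.+1 x (insert_at (s, n) k p) -> E s.
  by move=> kn hk; apply/asboolP; exists k => //; apply/asboolP.
(* What remains compares deletion and [e] with the number of signs having [E s]: a met deletion wall
   makes both half paths met, and [e] alone gives one. *)
case: b f w E H he pp pb EP => /= f w E H he pp pb EP; last first.
  rewrite big_cons big_nil addn0; case: e he => // /(_ isT)[s].
  by rewrite inE => /eqP-> [k kn /(EP _ _ kn) ->].
rewrite !big_cons big_nil addn0; have [hD|_] := boolP `[< meets_chamber true n x p >].
  have hE s : E s by apply: (EP s n) => //; apply: meets_delete => //; apply/asboolP.
  by rewrite !hE; case: (e).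
case: e he => // /(_ isT)[s _ [k kn /(EP _ _ kn)]].
by case: s => ->; case: (E _).
Qed.

(** Sum [chamber_count] over all words. If [x n] is zero the rank does not drop, but then every
    fibre is met. *)
Lemma count_meets_rec b n x : (0 < n)%N ->
  (\sum_(s <- signs b) \sum_(j < n) count_meets b n (merge x n j s)
   + (if b then count_meets b n x else 0)
   + (if x n == 0%R then size (words b n)
      else count_meets b n (fun i => x i *m cokermx (x n)))
   <= count_meets b n.+1 x)%N.
Proof.
move=> n0; pose e p := (x n == 0%R) || `[< meets_chamber b n (fun i => x i *m cokermx (x n)) p >].
have -> : (if x n == 0%R then size (words b n)
  else count_meets b n (fun i => x i *m cokermx (x n))) = (\sum_(p <- words b n) e p)%N.
  rewrite /e; case: eqP => // _; by rewrite sum1_size.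
have -> : (if b then count_meets b n x else 0)%N =
    (\sum_(p <- words b n) (b && `[< meets_chamber true n x p >]))%N.
  by case: (b) => //=; rewrite big1.
under eq_bigr do rewrite exchange_big /=.
rewrite exchange_big -!big_split /= /count_meets sum_words.
rewrite !big_seq; apply: leq_sum => p hp; apply: chamber_count => // /orP[/eqP xn|/asboolP].
  have [pp _] := wordsP hp.
  exists false; first by rewrite /signs; case: (b).
  by exists 0%N => //; apply: meets_zero.
by have [pp _] := wordsP hp; exact: meets_mod.
Qed.

Lemma size_words b n : size (words b n.+1) = (size (signs b) * n.+1 * size (words b n))%N.
Proof. by rewrite wordsS size_allpairs size_allpairs size_iota mulnC. Qed.

End Recursion.

(** * Solving the recursion *)

Section Bound.
Context {R : realType} {d : nat}.
Implicit Types (b : bool) (x : nat -> 'rV[R]_d).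

(** The factor 2 makes the bound at least 1, hence trivial, for [n <= 1] and [a <= 1]. *)
Definition decay (a : R) (n : nat) : R := 2 * n.+1%:R `^ (- a).

Lemma decay_ge0 a n : 0 <= decay a n.
Proof. by rewrite mulr_ge0 ?powR_ge0. Qed.

Lemma decay_ge1 a n : a <= 1 -> (n <= 1)%N -> 1 <= decay a n.
Proof.
move=> a1; case: n => [_|[_|//]]; rewrite /decay; first by rewrite powR1; lra.
have : (2 : R) `^ (- 1) <= 2 `^ (- a) by apply: ler_powR; lra.
by rewrite powR_inv1; lra.
Qed.

(** With [h = 1/(n+1)], the ratio of consecutive values is [expR (- a * ln (1 + h))], at least
    [1 - a * ln (1 + h)], hence at least [1 - a * h]. *)
Lemma decay_step a n : 0 <= a -> decay a n * (1 - a / n.+1%:R) <= decay a n.+1.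
Proof.
move=> a0; have n1 : (0 : R) < n.+1%:R by rewrite ltr0n.
have -> : decay a n.+1 = decay a n * expR (- (a * ln (1 + n.+1%:R^-1))).
  rewrite /decay -mulrA; congr (_ * _).
  rewrite /powR !pnatr_eq0 /= -expRD; congr expR.
  have -> : n.+2%:R = n.+1%:R * (1 + n.+1%:R^-1) :> R.
    by rewrite mulrDr mulr1 divff ?gt_eqF // -natr1.
  by rewrite lnM ?posrE ?addr_gt0 ?invr_gt0 //; ring.
apply: ler_wpM2l; first exact: decay_ge0.
apply: le_trans (expR_ge1Dx _); rewrite lerD2l lerN2; apply: ler_wpM2l => //.
by apply: le_ln1Dx; apply: lt_trans (ltrN10 _) _; rewrite invr_gt0.
Qed.

(* Quotienting by [x n] lowers the rank by one, which gains a factor [s]; the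
   recursion then averages to [(1 - 1/K) + s/K] with [K = 2(n+1)] or [n+1]. *)
Lemma count_meets_ge b (s : R) n r x (U : 'M[R]_d) : 0 < s < 1 ->
  (forall i, (i < n)%N -> (x i <= U)%MS) -> (\rank U <= r)%N ->
  (size (words b n))%:R * (1 - decay ((1 - s) / (size (signs b))%:R) n * s ^- r)
    <= (count_meets b n x)%:R.
Proof.
move=> /andP[s0 s1]; set v := (size (signs b))%:R : R; set a := (1 - s) / v.
have v1 : 1 <= v by rewrite /v /signs ler1n; case: (b).
have v0 : 0 < v by lra.
have a0 : 0 <= a by rewrite divr_ge0 //; lra.
have a1 : a <= 1 by rewrite ler_pdivrMr //; lra.
have sr1 k : 1 <= s ^- k by rewrite invf_ge1 ?exprn_gt0 // exprn_ile1 // ltW.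
have base m k y : (m <= 1)%N ->
    (size (words b m))%:R * (1 - decay a m * s ^- k) <= (count_meets b m y)%:R.
  move=> m1; apply: (@le_trans _ _ 0); last exact: ler0n.
  rewrite mulr_ge0_le0 // subr_le0 mulr_ege1 //; exact: decay_ge1.
elim: n r x U => [|n IH] r x U hx hU; first exact: base.
have [->|n0] := posnP n; first exact: base.
set N := (size (words b n))%:R : R; set B := decay a n * s ^- r.
have B0 : 0 <= B by rewrite mulr_ge0 ?decay_ge0 // (le_trans ler01 (sr1 r)).
have N0 : 0 <= N by rewrite ler0n.
have hxn i : (i < n)%N -> (x i <= U)%MS by move=> hi; apply: hx; exact: ltnW.
have hmerge s' j : (j < n)%N -> N * (1 - B) <= (count_meets b n (merge x n j s'))%:R.
  move=> jn; apply: (IH r _ U) => // i hi; rewrite /merge; case: ifP => _; last exact: hxn.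
  by apply: addmx_sub; [exact: hxn | apply: scalemx_sub; exact: hx].
have hdel : N * (1 - B) <= (count_meets b n x)%:R by apply: (IH r _ U).
have hmod : N * (1 - B * s) <= (if x n == 0 then size (words b n)
      else count_meets b n (fun i => x i *m cokermx (x n)))%:R.
  case: eqP => [_|/eqP xn]; first by rewrite ler_piMr // -/N; nra.
  (* The nonzero vector [x n] of [U] dies in the quotient, so the image of [U] has rank below [r];
     in particular [r] is positive and [B * s] is the bound for [r - 1]. *)
  have sub : (x n <= U :&: kermx (cokermx (x n)))%MS.
    by rewrite sub_capmx hx //; apply/sub_kermxP; rewrite mulmx_coker.
  have rk : (0 < \rank (U :&: kermx (cokermx (x n))))%N.
    by apply: leq_trans (mxrankS sub); rewrite lt0n mxrank_eq0.
  have := mxrank_mul_ker U (cokermx (x n)).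
  case: r hU @B B0 hmerge hdel => [|r] hU B B0 _ _ hr.
    by move: hU rk; rewrite -hr; lia.
  have -> : B * s = decay a n * s ^- r.
    by rewrite /B exprS invfM; field; rewrite expf_neq0 ?gt_eqF //= gt_eqF.
  apply: (IH r _ (U *m cokermx (x n))); first by move=> i /hxn hi; exact: submxMr.
  by rewrite -ltnS; apply: leq_trans hU; rewrite -hr -[X in (X < _)%N]addn0 ltn_add2l.
apply: le_trans (_ : _ <= _) _; last first.
  by have := count_meets_rec b x n0; rewrite -(@ler_nat R); apply: id.
rewrite !natrD.
(* [K] is the size of a fibre; it splits as [v * n] merges, [v - 1] deletions and one quotient. *)
pose K : R := v * n.+1%:R.
have hsum : (\sum_(s' <- signs b) \sum_(j < n) count_meets b n (merge x n j s'))%:R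
            >= v * n%:R * (N * (1 - B)).
  rewrite natr_sum -mulrA.
  have -> : v * (n%:R * (N * (1 - B))) = \sum_(s' <- signs b) n%:R * (N * (1 - B)).
    by rewrite big_const_seq count_predT iter_addr addr0 /v mulr_natl.
  apply: ler_sum => s' _; rewrite natr_sum.
  have -> : n%:R * (N * (1 - B)) = \sum_(j < n) (N * (1 - B)).
    by rewrite sumr_const card_ord mulr_natl.
  by apply: ler_sum => j _; exact: hmerge.
have hb : (v - 1) * (N * (1 - B)) <= (if b then count_meets b n x else 0)%:R.
  rewrite /v /signs; case: (b) hdel => /= hdel; first by apply: le_trans hdel; lra.
  by rewrite subrr mul0r.
have hdec := decay_step n a0.
have K0 : 0 < K by apply: (mulr_gt0 v0); rewrite ltr0n.
have aK : a / n.+1%:R = (1 - s) / K by rewrite /K /a invfM mulrA.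
have hB : B * (1 - (1 - s) / K) <= decay a n.+1 * s ^- r.
  rewrite /B mulrAC; apply: ler_wpM2r; first exact: le_trans ler01 (sr1 r).
  by rewrite -aK.
rewrite size_words !natrM -/v -/N -/K.
have {}hB : B * (K - (1 - s)) <= K * (decay a n.+1 * s ^- r).
  have := ler_wpM2l (ltW K0) hB; apply: le_trans; rewrite le_eqVlt; apply/orP; left.
  by apply/eqP; field; rewrite gt_eqF.
have KE : K = v * n%:R + v by rewrite /K -natr1 mulrDr mulr1.
apply: le_trans (lerD (lerD hsum hb) hmod).
have -> : v * n%:R * (N * (1 - B)) + (v - 1) * (N * (1 - B)) + N * (1 - B * s)
  = N * (K - B * (K - (1 - s))) by rewrite KE; ring.
have := ler_wpM2l N0 hB; lra.
Qed.

End Bound.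

(* An alias carrying the pointed structure required by [g_sigma_algebraType]. *)
Definition vector_tuple (R : realType) (n d : nat) := 'I_n -> 'rV[R]_d.
HB.instance Definition _ R n d := gen_eqMixin (vector_tuple R n d).
HB.instance Definition _ R n d := gen_choiceMixin (vector_tuple R n d).
HB.instance Definition _ R n d := isPointed.Build (vector_tuple R n d) (fun=> 0).

(** * Measurability of the hull event and the type D symmetry *)

Section Hull.
Context {R : realType} {n d : nat}.
Implicit Types (t : walk_type) (x : 'I_n -> 'rV[R]_d).

(** Index 0 is free because the hulls use only [psum x k] with [k > 0]; it encodes the extra type D
    point. *)
Definition hull_point x (k : nat) : 'rV[R]_d := if k == 0%N then psum_star x else psum x k.

Definition hull_index t : seq nat :=
  match t with
  | TypeA => iota 1 n.-1
  | TypeB => iota 1 n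
  | TypeD => rcons (iota 1 n) 0%N
  end.

Lemma hull_pointsE t x : hull_points t x = map (hull_point x) (hull_index t).
Proof.
have E m : [seq psum x k | k <- iota 1 m] = map (hull_point x) (iota 1 m).
  by apply/eq_in_map => k; rewrite mem_iota /hull_point; case: k.
by case: t; rewrite /hull_points /hull_index ?map_rcons E.
Qed.

Lemma measurable_psum (dT : measure_display) (T : measurableType dT)
    (Y : T -> 'I_n -> 'rV[R]_d) k j :
  random_tuple Y -> measurable_fun setT (fun w => psum (Y w) k ord0 j).
Proof.
move=> hY; rewrite (_ : (fun w => psum (Y w) k ord0 j) =
    fun w => \sum_(i < n) (if (i < k)%N then Y w i ord0 j else 0)).
  apply: measurable_sum => i; case: (i < k)%N; [exact: hY | exact: measurable_cst].
by apply/funext => w; rewrite /psum summxE big_mkcond.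
Qed.

Lemma measurable_hull_point (dT : measure_display) (T : measurableType dT)
    (Y : T -> 'I_n -> 'rV[R]_d) k j :
  random_tuple Y -> measurable_fun setT (fun w => hull_point (Y w) k ord0 j).
Proof.
move=> hY; rewrite /hull_point; case: (k == 0%N); last exact: measurable_psum.
rewrite (_ : (fun w => psum_star (Y w) ord0 j) = fun w => psum (Y w) n.-1 ord0 j -
    \sum_(i < n) (if i == n.-1 :> nat then Y w i ord0 j else 0)).
  apply: measurable_funB; first exact: measurable_psum.
  by apply: measurable_sum => i; case: (i == n.-1 :> nat); [exact: hY | exact: measurable_cst].
apply/funext => w; rewrite /psum_star mxE; congr (_ + _).
by rewrite mxE summxE big_mkcond.
Qed.

(** The complement is a countable union, over rational [q], of finite intersections of measurable
    conditions. *)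
Lemma measurable_hull (dT : measure_display) (T : measurableType dT)
    (Y : T -> 'I_n -> 'rV[R]_d) t :
  random_tuple Y -> measurable [set w | in_conv (hull_points t (Y w)) 0].
Proof.
move=> hY.
rewrite (_ : [set w | _] = ~` \bigcup_(q : 'rV[rat]_d)
    \big[setI/setT]_(k <- hull_index t)
       [set w | 0 < dot (hull_point (Y w) k) (map_mx ratr q)]).
  apply: measurableC; apply: countable_bigcupT_measurable => // q.
  apply: bigsetI_measurable => k _.
  have mg : measurable_fun setT (fun w => dot (hull_point (Y w) k) (map_mx ratr q)).
    by apply: measurable_sum => j; apply: measurable_funM => //; exact: measurable_hull_point.
  have := mg measurableT _ (@measurable_itv R `]0, +oo[); rewrite setTI.
  by congr measurable; apply/seteqP; split => w /=; rewrite in_itv /= andbT.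
apply/seteqP; split=> w /=; rewrite in_conv0P hull_pointsE.
  move=> h [q _]; rewrite -bigcap_seq => hq; apply: h; exists (map_mx ratr q).
  by move=> _ /mapP[k hk ->]; exact: hq.
move=> h [y /open_halfspace_rat[q hq]]; apply: h; exists q => //.
by rewrite -bigcap_seq => k hk /=; apply: hq; exact: map_f.
Qed.

(** The identity on tuples, under the generated sigma-algebra, is itself a random tuple, so
    [measurable_hull] applies to it. *)
Lemma borel_hull t :
  borel_tuple [set x : 'I_n -> 'rV[R]_d | in_conv (hull_points t x) 0].
Proof.
pose G : set (set (vector_tuple R n d)) := @coord_halfspaces R n d.
suff hid : @random_tuple R _ (g_sigma_algebraType G) n d (fun x => x).
  exact: (measurable_hull t hid).
move=> i j; apply: (measurability _ (RGenOInfty.measurableE R)) => _ [_ [c ->] <-].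
rewrite setTI (_ : _ @^-1` _ = ~` [set x : 'I_n -> 'rV[R]_d | x i ord0 j <= c]).
  by apply: measurableC; apply: sub_sigma_algebra; exists i, j, c.
apply/seteqP; split => x /=; rewrite in_itv /= andbT; first by rewrite ltNge => /negP.
by move=> /negP; rewrite -ltNge.
Qed.

Definition flip_last x (i : 'I_n) : 'rV[R]_d := if i == n.-1 :> nat then - x i else x i.

Lemma flip_lastK x : flip_last (flip_last x) = x.
Proof. by apply/funext => i; rewrite /flip_last; case: (i == n.-1 :> nat) => //; rewrite opprK. Qed.

Lemma psum_flip_lt x k : (k < n)%N -> psum (flip_last x) k = psum x k.
Proof. by move=> kn; apply: eq_bigr => i ik; rewrite /flip_last ltn_eqF //; lia. Qed.

Lemma psum_split x : (0 < n)%N ->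
  psum x n = psum x n.-1 + \sum_(i < n | i == n.-1 :> nat) x i.
Proof.
move=> n0; rewrite /psum (bigID (fun i : 'I_n => (i < n.-1)%N)) /=; congr (_ + _).
  by apply: eq_bigl => i; case: i => i /=; lia.
by apply: eq_bigl => i; case: i => i /=; lia.
Qed.

Lemma sum_flip x : \sum_(i < n | i == n.-1 :> nat) flip_last x i =
  - \sum_(i < n | i == n.-1 :> nat) x i.
Proof. by rewrite -sumrN; apply: eq_bigr => i; rewrite /flip_last => ->. Qed.

(** Flipping the last step exchanges [psum x n] with [psum_star x] and fixes the other points. One
    inclusion suffices, since the flip is an involution. *)
Lemma in_conv_flip x : (0 < n)%N ->
  in_conv (hull_points TypeD (flip_last x)) 0 <-> in_conv (hull_points TypeD x) 0.
Proof.
move=> n0; have sub z : {subset hull_points TypeD (flip_last z) <= hull_points TypeD z}.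
  move=> v; rewrite mem_rcons inE => /orP[/eqP->|/mapP[k]].
    apply/(@mem_subseq _ [:: psum z n]); last first.
      by rewrite inE /psum_star sum_flip opprK psum_flip_lt ?psum_split //; lia.
    rewrite sub1seq mem_rcons inE; apply/orP; right; apply: map_f; rewrite mem_iota; lia.
  rewrite mem_iota => /andP[k1 kn] ->; rewrite mem_rcons inE.
  have [kn'|] := ltnP k n.
    by rewrite psum_flip_lt // map_f ?orbT // mem_iota k1.
  move=> nk; have -> : k = n by lia.
  by rewrite psum_split // sum_flip psum_flip_lt ?eqxx //; lia.
by split; rewrite !in_conv0P => h [y hy]; apply: h; exists y => v vs; apply: hy;
  [|rewrite -(flip_lastK x) in vs]; exact: sub.
Qed.

End Hull.

(** * From linear relations to hulls containing 0 *)

Section Abel.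
Context {R : realFieldType}.
Implicit Types nu z : nat -> R.

Lemma abel_summation nu z n :
  \sum_(k < n.+1) nu k * z k =
  \sum_(k < n) (nu k - nu k.+1) * (\sum_(i < k.+1) z i) + nu n * \sum_(i < n.+1) z i.
Proof.
elim: n => [|n IH]; first by rewrite big_ord0 !big_ord1 add0r.
rewrite big_ord_recr /= IH [in RHS]big_ord_recr /= [\sum_(i < n.+2) z i]big_ord_recr /=.
ring.
Qed.

(** All terms of the Abel sum are nonnegative and add up to 0, so each vanishes; positive partial
    sums then force equal consecutive [nu]. *)
Lemma abel_rigidity nu z n :
  (forall k, (k < n)%N -> nu k.+1 <= nu k) ->
  (forall k, (k < n)%N -> 0 < \sum_(i < k.+1) z i) ->
  0 <= nu n * \sum_(i < n.+1) z i -> \sum_(k < n.+1) nu k * z k = 0 ->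
  (forall k, (k <= n)%N -> nu k = nu n) /\ nu n * \sum_(i < n.+1) z i = 0.
Proof.
move=> hnu hz hn; rewrite abel_summation => /eqP.
have h0 (k : 'I_n) : 0 <= (nu k - nu k.+1) * \sum_(i < k.+1) z i.
  by rewrite mulr_ge0 ?subr_ge0 ?hnu // ltW ?hz.
rewrite paddr_eq0 ?sumr_ge0 // => /andP[hk /eqP hn0]; split=> //.
move: hk; rewrite psumr_eq0 // => /allP hk.
have step k : (k < n)%N -> nu k = nu k.+1.
  move=> kn; have := hk (Ordinal kn) (mem_index_enum _).
  by rewrite /= mulf_eq0 (gt_eqF (hz _ kn)) orbF subr_eq0 => /eqP.
move=> k kn; suff H m : (k + m <= n)%N -> nu k = nu (k + m)%N by rewrite (H (n - k)%N) subnKC.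
elim: m => [|m IH]; first by rewrite addn0.
by rewrite addnS => km; rewrite -step // IH // ltnW.
Qed.

End Abel.

Section WordAction.
Context {R : realType} {n d : nat}.
Implicit Types (b : bool) (t : walk_type) (x : 'I_n.+1 -> 'rV[R]_d) (p : seq (bool * nat)).

Definition has_signs t : bool := if t is TypeA then false else true.

Definition word_act p x (i : 'I_n.+1) : 'rV[R]_d :=
  let c := nth (false, 0%N) p i in (-1) ^+ c.1 *: x (inord c.2).

Lemma size_word b m p : p \in words b m -> size p = m.
Proof. by move=> /wordsP[/perm_size]; rewrite size_map size_iota. Qed.

Lemma word_act_perm b p : p \in words b n.+1 ->
  exists (s : 'S_n.+1) (e : 'I_n.+1 -> R), [/\ is_sign e, ~~ b -> e = fun=> 1 &
    forall x, word_act p x = fun i => e i *: x (s i)].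
Proof.
move=> hp; have sp := size_word hp; have [pp pb] := wordsP hp.
pose c (i : 'I_n.+1) := nth (false, 0%N) p i.
have cn i : ((c i).2 < n.+1)%N.
  have : (c i).2 \in map snd p by apply/map_f/mem_nth; rewrite sp.
  by rewrite (perm_mem pp) mem_iota.
have inj : injective (fun i => inord (c i).2 : 'I_n.+1).
  move=> i j /(congr1 val); rewrite /= !inordK // /c.
  rewrite -!(nth_map _ 0%N snd) ?sp // => /eqP.
  rewrite nth_uniq ?size_map ?sp // ?(perm_uniq pp) ?iota_uniq // => /eqP.
  exact: val_inj.
exists (perm inj), (fun i => (-1) ^+ (c i).1); split.
- by move=> i; case: (c i).1; [right | left].
- move=> nb; apply/funext => i.
  suff /negbTE-> : ~~ (c i).1 by [].
  by apply: (allP (pb nb)); apply: mem_nth; rewrite sp.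
- by move=> x; apply/funext => i; rewrite permE.
Qed.

(** If 0 were missed, some [y] would be positive on all hull points. Pairing the relation with [y]
    along the word and applying [abel_rigidity] makes [mu] trivial. *)
Lemma meets_in_conv t x p : p \in words (has_signs t) n.+1 ->
  (t = TypeA -> psum x n.+1 = 0) ->
  meets_chamber (has_signs t) n.+1 (fun i => x (inord i)) p ->
  in_conv (hull_points t (word_act p x)) 0.
Proof.
move=> hp hx [mu [hs hpw ha [i0 [j0 /and3P[hi0 hj0 hmu]]]]].
have sp := size_word hp; have [pp pb] := wordsP hp.
rewrite in_conv0P => -[y hy].
(* [nu] and [Y] carry the same sign, which cancels in their product. *)
pose c := nth (false, 0%N) p; pose nu k := signed_value mu (c k).
pose Y k := (-1) ^+ (c k).1 *: x (inord (c k).2).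
pose z k := dot (Y k) y.
have sum_perm (S : nmodType) (F : nat -> S) :
    \sum_(k < n.+1) F (c k).2 = \sum_(i < n.+1) F i.
  rewrite -(big_mkord xpredT (fun k => F (c k).2)) -[in index_iota _ _]sp.
  rewrite -(big_nth _ xpredT (fun c => F c.2)) -(big_map snd xpredT) (perm_big _ pp).
  by rewrite -(big_mkord xpredT) /index_iota subn0.
have psumE k : (k <= n.+1)%N -> dot (psum (word_act p x) k) y = \sum_(i < k) z i.
  move=> kn; transitivity (\sum_(i < k) 1 * dot (Y i) y).
    rewrite -(dot_suml k (fun=> 1)); congr dot.
    rewrite /psum (big_ord_widen n.+1 (fun i => 1 *: Y i)) //.
    by apply: eq_bigr => i _; rewrite scale1r.
  by apply: eq_bigr => i _; rewrite mul1r.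
have hnu k : (k < n)%N -> nu k.+1 <= nu k.
  move=> kn; have := hpw; rewrite -sorted_pairwise; last first.
    by move=> u v w /= h1 h2; exact: le_trans h2 h1.
  move=> /(sortedP 0)/(_ k); rewrite size_map sp ltnS => /(_ kn).
  by rewrite !(nth_map (false, 0%N)) ?sp // ltnW.
have nuz : \sum_(k < n.+1) nu k * z k = 0.
  rewrite -(dot_suml n.+1 nu Y y).
  rewrite (_ : \sum_(k < n.+1) _ = 0); first by rewrite /dot big1 // => j _; rewrite mxE mul0r.
  rewrite -[RHS]hs -(sum_perm _ (fun i => mu i *: x (inord i))); apply: eq_bigr => k _.
  by rewrite /nu /Y /signed_value scalerA mulrAC -expr2 sqrr_sign mul1r.
have hpt k : k \in @hull_index n.+1 t -> (0 < k <= n.+1)%N -> 0 < \sum_(i < k) z i.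
  move=> kt /andP[k0 kn]; rewrite -psumE //; apply: hy; rewrite hull_pointsE.
  by apply/mapP; exists k => //; rewrite /hull_point eqn0Ngt k0.
have hz k : (k < n)%N -> 0 < \sum_(i < k.+1) z i.
  move=> kn; apply: hpt; last lia.
  by case: (t); rewrite /hull_index ?mem_rcons ?inE mem_iota /=; lia.
have musigned i : (i < n.+1)%N -> exists2 k : nat, (k <= n)%N & nu k = (-1) ^+ (c k).1 * mu i.
  move=> hi; have : i \in map snd p by rewrite (perm_mem pp) mem_iota.
  move=> /mapP[ci hci ->]; exists (index ci p); first by rewrite -ltnS -[in X in (_ < X)%N]sp index_mem.
  by rewrite /nu /c nth_index.
have [tA|tA] := boolP (has_signs t); last first.
  have {}tA : t = TypeA by case: (t) tA.
  subst t; move: hmu; rewrite /= in pb ha *; move=> /negP; apply; apply/eqP.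
  (* In type A the walk closes up, so the boundary term vanishes whatever the sign of [nu n]. *)
  have Z0 : \sum_(i < n.+1) z i = 0.
    rewrite -psumE // (_ : psum _ _ = 0); first by rewrite /dot big1 // => j _; rewrite mxE mul0r.
    rewrite -[RHS](hx erefl) /psum.
    rewrite (eq_bigl xpredT) => [|i]; last exact: ltn_ord.
    rewrite [RHS](eq_bigl xpredT) => [|i]; last exact: ltn_ord.
    rewrite (eq_bigr (fun i : 'I_n.+1 => x (inord (c i).2))) => [|i _].
      by rewrite (sum_perm _ (fun i => x (inord i))); apply: eq_bigr => i _; rewrite inord_val.
    rewrite /word_act -/(c i); have /negbTE-> : ~~ (c i).1; last by rewrite scale1r.
    by apply: (allP (pb isT)); apply: mem_nth; rewrite sp.
  have [|hc _] := abel_rigidity hnu hz _ nuz; first by rewrite Z0 mulr0.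
  have mu_const i : (i < n.+1)%N -> mu i = nu n.
    move=> /musigned[k kn]; rewrite (hc k kn) => ->.
    have /negbTE-> : ~~ (c k).1; last by rewrite mul1r.
    by apply: (allP (pb isT)); apply: mem_nth; rewrite sp ltnS.
  by rewrite !mu_const.
rewrite tA in ha; move: hmu; rewrite tA => /negP; apply; apply/eqP.
(* In types B and D the full sum is a hull point, so the vanishing boundary term forces
   [nu n = 0]. *)
have Zn : 0 < \sum_(i < n.+1) z i.
  apply: hpt; last lia.
  by case: (t) tA => // _; rewrite /hull_index ?mem_rcons ?inE mem_iota /=; lia.
have nun : 0 <= nu n.
  by have /allP := ha isT; apply; apply: map_f; apply: mem_nth; rewrite sp.
have [|hc /eqP] := abel_rigidity hnu hz _ nuz; first by rewrite mulr_ge0 // ltW.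
rewrite mulf_eq0 (gt_eqF Zn) orbF => /eqP nu0.
have [k kn] := musigned i0 hi0; rewrite (hc k kn) nu0 => /esym/eqP.
by rewrite mulf_eq0 signr_eq0 => /eqP.
Qed.

End WordAction.

(** * Averaging over words *)

Section Probability.
Context {R : realType} {dT : measure_display} {T : measurableType dT} (P : probability T R).

Lemma random_tuple_act n d (X : T -> 'I_n -> 'rV[R]_d) (s : 'S_n) (e : 'I_n -> R) :
  random_tuple X -> random_tuple (fun w i => e i *: X w (s i)).
Proof.
move=> hX i j; rewrite (_ : (fun w => _) = fun w => e i * X w (s i) ord0 j).
  by apply: measurable_funM; [exact: measurable_cst | exact: hX].
by apply/funext => w; rewrite mxE.
Qed.

Lemma average_le (I : Type) (r : seq I) (E : I -> set T) (D : set T) (c : R) :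
  measurable D -> P D = 1%E -> (forall i, measurable (E i)) ->
  (forall w, D w -> c <= \sum_(i <- r) `[< E i w >]%:R) ->
  (c%:E <= \sum_(i <- r) P (E i))%E.
Proof.
move=> mD PD mE hc.
have intD (a : R) : (\int[P]_(w in D) cst a%:E w)%E = a%:E.
  by rewrite integral_cst // [X in (_ * X)%E]PD mule1.
rewrite -(intD c).
(* The constant [c] may be negative, while monotonicity is applied to nonnegative integrands. *)
apply: (@le_trans _ _ (\int[P]_(w in D) cst (Num.max c 0)%:E w)%E).
  by rewrite !intD lee_fin le_max lexx.
apply: (@le_trans _ _ (\int[P]_(w in D) \sum_(i <- r) (\1_(E i) w)%:E)%E).
  have mI i : measurable_fun D (fun w => (\1_(E i) w : R)%:E).
    by apply/measurable_EFinP; exact: measurable_indic.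
  apply: ge0_le_integral => //.
  - by move=> w _; rewrite lee_fin le_max lexx orbT.
  - exact: emeasurable_sum.
  move=> w Dw; rewrite sumEFin lee_fin ge_max sumr_ge0 ?andbT //.
  apply: le_trans (hc w Dw) _; apply: ler_sum => i _; rewrite indicE.
  by rewrite -[w \in E i]/(`[< E i w >]).
rewrite ge0_integral_sum //; last first.
  by move=> i; apply/measurable_EFinP; exact: measurable_indic.
apply: lee_sum => i _; rewrite integral_indic //; apply: le_measure; rewrite ?inE //.
exact: measurableI.
Qed.

Lemma word_act_invariance t n d (X : T -> 'I_n.+1 -> 'rV[R]_d) p :
  walk_assumptions t P X -> p \in words (has_signs t) n.+1 ->
  measurable [set w | in_conv (hull_points t (word_act p (X w))) 0] /\
  P [set w | in_conv (hull_points t (word_act p (X w))) 0] =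
  P [set w | in_conv (hull_points t (X w)) 0].
Proof.
move=> [hX ht] /(@word_act_perm R n d)[s [e [he he1 hact]]].
have -> : [set w | in_conv (hull_points t (word_act p (X w))) 0] =
    [set w | in_conv (hull_points t (fun i => e i *: X w (s i))) 0].
  by apply/seteqP; split => w /=; rewrite hact.
split; first exact/measurable_hull/random_tuple_act.
have inv (e' : 'I_n.+1 -> R) : same_law P X (fun w i => e' i *: X w (s i)) ->
    P [set w | in_conv (hull_points t (fun i => e' i *: X w (s i))) 0] =
    P [set w | in_conv (hull_points t (X w)) 0].
  by move=> /(_ _ (borel_hull t))->.
case: t ht he1 inv => [[_ [hA _]] he1|[_ hB] _|[_ hD] _] inv.
- apply: inv; rewrite (_ : (fun w i => _) = fun w i => X w (s i)); first exact: hA.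
  by apply/funext => w; apply/funext => i; rewrite he1 // scale1r.
- exact/inv/hB.
have [pe|pe] : \prod_i e i = 1 \/ \prod_i e i = -1.
  elim/big_ind: _ => //; first by left.
  - by move=> a c [->|->] [->|->]; rewrite ?mulr1 ?mul1r ?mulrNN ?mulr1; auto.
  exact/inv/hD.
(* Type D signs with product -1 are not covered by the invariance; changing the last sign repairs
   the product and leaves the hull event unchanged. *)
pose e' i := if i == ord_max then - e i else e i.
have he' : is_sign e'.
  by move=> i; rewrite /e'; case: ifP => _; case: (he i) => ->; rewrite ?opprK; auto.
have pe' : \prod_i e' i = 1.
  rewrite (bigD1 ord_max) //= /e' eqxx mulNr; apply/eqP; rewrite eqr_oppLR -pe; apply/eqP.
  rewrite [in RHS](bigD1 ord_max) //=; congr (_ * _).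
  by apply: eq_bigr => i /negbTE->.
rewrite -(inv e' (hD s e' he' pe')); congr (P _); apply/seteqP.
have flipE w : (fun i => e' i *: X w (s i)) = flip_last (fun i => e i *: X w (s i)).
  apply/funext => i; rewrite /flip_last /e' -[n.+1.-1]/(nat_of_ord (@ord_max n)).
  by rewrite (inj_eq val_inj); case: ifP => _; rewrite ?scaleNr.
by split=> w; rewrite /mkset flipE in_conv_flip.
Qed.

Lemma hull_prob_ge t n d (X : T -> 'I_n.+1 -> 'rV[R]_d) (s : R) : 0 < s < 1 ->
  walk_assumptions t P X ->
  ((1 - decay ((1 - s) / (size (signs (has_signs t)))%:R) n.+1 * s ^- d)%:E <=
   P [set w | in_conv (hull_points t (X w)) 0])%E.
Proof.
move=> s01 hX; set b := has_signs t; set B := 1 - _.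
pose N := size (words b n.+1).
have N0 : (0 : R) < N%:R.
  rewrite ltr0n /N; elim: n.+1 => // m IH; rewrite size_words !muln_gt0 IH /=.
  by rewrite /signs; case: (b).
(* Membership of [p] is put into the event to make it measurable for every [p]. *)
have mE p : measurable [set w | p \in words b n.+1 /\
    in_conv (hull_points t (word_act p (X w))) 0].
  have [pw|pw] := boolP (p \in words b n.+1).
    have [+ _] := word_act_invariance hX pw.
    by congr measurable; apply/seteqP; split => w /=; [|case].
  rewrite (_ : [set w | _] = set0) //.
  by apply/seteqP; split => w //= -[].
pose D := [set w | t = TypeA -> psum (X w) n.+1 = 0].
have [mD PD] : measurable D /\ P D = 1%E.
  have [tA|tA] := pselect (t = TypeA); last first.
    have -> : D = setT by apply/seteqP; split => w //= _ /tA.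
    by rewrite probability_setT.
  have DE : D = [set w | psum (X w) n.+1 = 0].
    by apply/seteqP; split => w /=; [exact | move=> + _].
  case: hX; rewrite tA => hX [_ [_ h]]; split; last by rewrite DE.
  rewrite DE (_ : [set w | _] = \big[setI/setT]_(j < d) [set w | psum (X w) n.+1 ord0 j = 0]).
    apply: bigsetI_measurable => j _.
    have := measurable_psum n.+1 j hX measurableT (@measurable_set1 R 0).
    by rewrite setTI.
  apply/seteqP; split => w /=; rewrite -bigcap_seq.
    by move=> hw j _; rewrite /= hw mxE.
  by move=> h0; apply/rowP => j; rewrite mxE; apply: h0; exact: mem_index_enum.
have := @average_le _ (words b n.+1) _ D (N%:R * B) mD PD mE.
have -> : (\sum_(p <- words b n.+1) P [set w | p \in words b n.+1 /\
    in_conv (hull_points t (word_act p (X w))) 0])%E =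
    (N%:R%:E * P [set w | in_conv (hull_points t (X w)) 0])%E.
  rewrite big_seq (eq_bigr (fun=> P [set w | in_conv (hull_points t (X w)) 0])).
    rewrite -big_seq; set q := P _.
    have <- : (fine q)%:E = q.
      by apply/fineK/fin_num_measure; apply: measurable_hull; exact: hX.1.
    by rewrite sumEFin big_const_seq count_predT iter_addr addr0 -EFinM mulr_natl.
  move=> p pw; rewrite -(word_act_invariance hX pw).2; congr (P _).
  by apply/seteqP; split => w /=; [case|].
rewrite EFinM lee_pmul2l //; apply => w Dw.
apply: le_trans (@count_meets_ge R d b s n.+1 d (fun i => X w (inord i)) 1%:M s01 _ _) _.
- by move=> i _; exact: submx1.
- by rewrite mxrank1.
rewrite /count_meets natr_sum !big_seq; apply: ler_sum => p pw.
rewrite ler_nat; case: asboolP => // hm; case: asboolP => //; case.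
by split=> //; exact: meets_in_conv.
Qed.

End Probability.

(** * Choice of the exponent [delta] *)

Theorem theorem5p7 (R : realType) (t : walk_type) (eps : R) :
  0 < eps < 2^-1 ->
  exists delta C : R, 0 < delta < 1 /\ 0 < C /\
    forall (d n : nat), expR (d%:R / (u_of t - eps)) < n%:R ->
    forall (dT : measure_display) (T : measurableType dT) (P : probability T R)
           (X : T -> 'I_n -> 'rV[R]_d),
      walk_assumptions t P X ->
      ((1 - C * (n%:R `^ (- delta)))%:E <= P [set w | in_conv (hull_points t (X w)) 0])%E.
Proof.
move=> /andP[e0 e1]; set u : R := u_of t.
have u0 : 2^-1 <= u by rewrite /u; case: (t) => /=; lra.
have uE : (size (signs (has_signs t)))%:R = u^-1.
  by rewrite /u; case: (t); rewrite /= ?invr1 ?invrK.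
(* This makes the exponent [(1 - s) * u] of the decay equal to [eps]. *)
pose s := (u - eps) / u.
have ue0 : 0 < u - eps by lra.
have up : 0 < u by lra.
have s0 : 0 < s by rewrite divr_gt0.
have s1 : s < 1 by rewrite ltr_pdivrMr // mul1r; lra.
have as_eps : (1 - s) / u^-1 = eps by rewrite /s; field; rewrite gt_eqF.
(* As [d <= (u - eps) * ln n], the factor [s ^- d] costs at most the power [- (u - eps) * ln s] of
   [n]. The strict bound [1 + x < expR x] at [x = - ln s] gives [0 < delta]. *)
pose delta := eps + (u - eps) * ln s.
have lns : ln s < 0 by rewrite ln_lt0 // s0.
have delta0 : 0 < delta.
  have := @expR_gt1Dx R (- ln s); rewrite oppr_eq0 lt_eqF // => /(_ isT).
  rewrite expRN lnK ?posrE // => h.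
  have : (u - eps) * (1 - ln s) < (u - eps) * s^-1 by rewrite ltr_pM2l.
  have -> : (u - eps) * s^-1 = u by rewrite /s; field; rewrite !gt_eqF.
  rewrite /delta; lra.
have delta1 : delta < 1.
  have : (u - eps) * ln s < 0 by rewrite pmulr_rlt0.
  rewrite /delta; lra.
exists delta, 2; split; first exact/andP.
split=> // d n hn dT T P X hX.
have n0 : 0 < n%:R :> R by apply: lt_trans hn; exact: expR_gt0.
case: n => [|n] in hn X hX n0 *; first by rewrite ltxx in n0.
have s01 : 0 < s < 1 by rewrite s0.
apply: le_trans (hull_prob_ge s01 hX); rewrite lee_fin lerD2l lerN2 uE as_eps /decay.
rewrite -mulrA; apply: ler_wpM2l => //.
have hd : d%:R <= (u - eps) * ln n.+1%:R.
  rewrite mulrC -ler_pdivrMr // -ler_expR lnK ?posrE //; exact: ltW.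
have -> : s ^- d = expR (- (d%:R * ln s)).
  by rewrite expRN mulrC expRM_natr lnK // posrE.
have -> : n.+1%:R `^ (- delta) = n.+1%:R `^ (- eps) * expR (- ((u - eps) * ln n.+1%:R * ln s)).
  rewrite /powR pnatr_eq0 /= -expRD; congr expR; rewrite /delta; ring.
apply: ler_pM; rewrite ?powR_ge0 ?expR_ge0 //.
  (* [decay] at [n.+1] has base [n.+2], which is only better than [n.+1]. *)
  rewrite !powRN lef_pV2 ?posrE ?powR_gt0 //.
  by apply: ge0_ler_powR; rewrite ?nnegrE ?ler_nat ?ltW.
by rewrite ler_expR lerN2 ler_wnM2r // ltW.
Qed.
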